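(* Let $M\in\mathbb{N}$ be even, $M\ge2$, and $n=M/2$. The Gramian closure $\mathcal{C}:\mathcal{R}\to\mathbb{R}$, $$u_{2n+1}=\mathcal{C}(u_0,\dots,u_{2n})=u_{n+1,2n}^{T}G_{n-1}^{-1}u_{n,2n-1},$$ is strictly hyperbolic.
   Context: Realizable moments: $\mathcal{R}\subset\mathbb{R}^{M+1}$ is the set of vectors $(u_0,\dots,u_M)$ with $u_k=\int_{\mathbb{R}}c^kf(c)\,dc$ for some measurable $f:\mathbb{R}\to[0,\infty)$, not almost everywhere zero, with finite moments up to order $M$. This is an open subset of $\mathbb{R}^{M+1}$. Gramian matrix: $G_k=(u_{i+j})_{i,j=0,\dots,k}\in\mathbb{R}^{(k+1)\times(k+1)}$; it is symmetric positive definite for $2k\le M$ and realizable moments. For $k\le l$, $u_{k,l}=(u_k,u_{k+1},\dots,u_l)^T\in\mathbb{R}^{l-k+1}$. Characteristic polynomial of a closure $u_{M+1}=\mathcal{C}(u_0,\dots,u_M)$: $\mathcal{P}_{M+1}(z)=z^{M+1}-\sum_{j=0}^{M}\frac{\partial\mathcal{C}}{\partial u_j}(u_0,\dots,u_M)\,z^j$. Strict hyperbolicity: $\mathcal{C}$ is strictly hyperbolic if $\mathcal{P}_{M+1}$ has $M+1$ distinct real roots for all $(u_0,\dots,u_M)\in\mathcal{R}$. *)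

(* Defs.v *)
From mathcomp Require Import all_boot all_order all_algebra.
From mathcomp Require Import all_classical all_reals all_analysis.
Set Implicit Arguments.
Unset Strict Implicit.
Unset Printing Implicit Defensive.
Import Order.TTheory GRing.Theory Num.Theory.
Import numFieldNormedType.Exports.
Local Open Scope classical_set_scope.
Local Open Scope ring_scope.

(* Every Lebesgue-measurable f agrees a.e. with a Borel one, so Borel and
   Lebesgue measurability of f give the same set. *)
Definition realizable (R : realType) (M : nat) : set 'cV[R]_M.+1 :=
  [set u : 'cV[R]_M.+1 | exists f : R -> R,
    [/\ measurable_fun setT f,
        forall c, 0 <= f c,
        ~ {ae lebesgue_measure, forall c, f c = 0},
        forall k : 'I_M.+1,
          lebesgue_measure.-integrable setT (fun c => (c ^+ k * f c)%:E)
      & forall k : 'I_M.+1,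
          u k 0 = \int[lebesgue_measure]_c (c ^+ k * f c)]].

(* u_k for a natural number k; meaningful only for k <= M. *)
Definition moment (R : realType) (M : nat) (u : 'cV[R]_M.+1) (k : nat) : R :=
  u (inord k) 0.

(* Indexed by the size: G_k is [gramian u k.+1]. *)
Definition gramian (R : realType) (M : nat) (u : 'cV[R]_M.+1) (m : nat) :
    'M[R]_m :=
  \matrix_(i < m, j < m) moment u (i + j).

(* Indexed by the first index and the length: u_{k,l} is
   [moments_from u k (l - k).+1]. *)
Definition moments_from (R : realType) (M : nat) (u : 'cV[R]_M.+1)
    (k m : nat) : 'cV[R]_m :=
  \col_(i < m) moment u (k + i).

(* u_{n+1,2n}^T G_{n-1}^{-1} u_{n,2n-1}, where both vectors have length n and
   G_{n-1} has size n. *)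
Definition gramian_closure (R : realType) (M n : nat) (u : 'cV[R]_M.+1) : R :=
  ((moments_from u n.+1 n)^T *m invmx (gramian u n) *m moments_from u n n) 0 0.

(* A closure is represented by a function on the whole space; since the set of
   realizable moments is open, its partial derivatives at a realizable u only
   depend on its values at realizable moments. *)
Definition char_poly_closure (R : realType) (M : nat) (C : 'cV[R]_M.+1 -> R)
    (u : 'cV[R]_M.+1) : {poly R} :=
  'X^(M.+1) - \sum_(j < M.+1) ('D_(delta_mx j 0) C u) *: 'X^j.

(* ['D_v C u] is total, so the existence of the partial derivatives, implicit
   in the characteristic polynomial, is required explicitly. *)
Definition strictly_hyperbolic (R : realType) (M : nat)
    (C : 'cV[R]_M.+1 -> R) : Prop :=
  forall u : 'cV[R]_M.+1, realizable u ->
    (forall j : 'I_M.+1, derivable C u (delta_mx j 0)) /\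
    exists z : seq R,
      [/\ size z = M.+1, uniq z & all (root (char_poly_closure C u)) z].

(* Main.v *)
Require Import Defs.
From HB Require Import structures.
From mathcomp Require Import all_boot all_order all_algebra.
From mathcomp Require Import all_classical all_reals all_analysis.
From mathcomp Require Import measurable_realfun complex ring.

(** Let L be the functional sending X^k to u_k; realizability makes L(p^2) > 0
    for nonzero p of degree at most n. Since the closure is b^T G^-1 a with
    a = u_{n,2n-1}, b = u_{n+1,2n}, differentiating it and replacing du_j by z^j
    yields a characteristic polynomial that factors as
    (z^n - p(z)) (z^{n+1} - q(z)), where p and q have coefficient vectors G^-1 a
    and G^-1 b. Both factors A are L-orthogonal to all polynomials of degree
    less than n. If A = ((z - s)^2 + t^2) B, then
    0 = L(A B) = L(((z - s) B)^2) + t^2 L(B^2) > 0, so A has no non-real and no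
    multiple root. If the factors P = (z - s) C and Q = (z - s) D had a common
    root, then 0 = L(Q C) = L(P D) = L(P^2) > 0, since D - P has degree less
    than n. *)

Set Implicit Arguments.
Unset Strict Implicit.
Unset Printing Implicit Defensive.
Import Order.TTheory GRing.Theory Num.Theory.
Import numFieldNormedType.Exports.
Local Open Scope classical_set_scope.
Local Open Scope ring_scope.

(** * Real-rootedness from the absence of real quadratic divisors *)

Lemma size_mulXsubC {R : nzRingType} (p : {poly R}) (x : R) :
  p != 0 -> size (p * ('X - x%:P)) = (size p).+1.
Proof. by move=> p0; rewrite size_Mmonic ?monicXsubC // size_XsubC addn2. Qed.

Lemma leq_size_monicB {R : nzRingType} (n : nat) (p q : {poly R}) :
  p \is monic -> q \is monic -> size p = n.+1 -> size q = n.+1 ->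
  (size (p - q)%R <= n)%N.
Proof.
move=> mp mq szp szq; apply/leq_sizeP => j; rewrite coefB leq_eqVlt.
case/predU1P => [<-|nj]; last by rewrite !nth_default ?subr0 ?szp ?szq.
move: mp mq; rewrite !monicE /lead_coef szp szq => /eqP-> /eqP->.
exact: subrr.
Qed.

(* For [t = 0] this is the square of ['X - s%:P], so being free of such divisors
   excludes multiple real roots as well as non-real ones. *)
Definition quad {R : nzRingType} (s t : R) : {poly R} :=
  ('X - s%:P) ^+ 2 + (t ^+ 2)%:P.

Lemma size_quad {R : idomainType} (s t : R) : size (quad s t) = 3%N.
Proof.
rewrite /quad size_polyDl size_exp_XsubC //.
by rewrite (leq_ltn_trans (size_polyC_leq1 _)).
Qed.

(** The remainder modulo [quad a b] has the form [r0 + r1 X] and still vanishes at [a + ib]. The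
    imaginary part of that value is [r1 b], so [r1 = 0], and then the real part gives [r0 = 0]. *)
Lemma quad_dvd_of_complex_root {R : rcfType} (A : {poly R}) (a b : R) :
  b != 0 -> root (map_poly (real_complex R) A) (a +i* b)%C -> quad a b %| A.
Proof.
move=> b0 rA; rewrite /dvdp.
have sz : (size (A %% quad a b)%R <= 2)%N.
  by rewrite -ltnS -(size_quad a b) ltn_modp -size_poly_gt0 size_quad.
have rq : root (map_poly (real_complex R) (quad a b)) (a +i* b)%C.
  rewrite /root /quad rmorphD rmorphXn rmorphB /= map_polyX !map_polyC /=.
  rewrite !hornerE expr2; apply/eqP; simpc.
  by congr (_ +i* _)%C; ring.
move: rA; rewrite {1}(divp_eq A (quad a b)) rmorphD rmorphM /= /root.
rewrite hornerD hornerM (eqP rq) mulr0 add0r.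
set r := (A %% quad a b)%R in sz *.
have -> : r = (r`_0)%:P + r`_1 *: 'X.
  apply/polyP => -[|[|k]]; rewrite !coefE /= ?mulr0 ?addr0 ?add0r ?mulr1 //.
  by rewrite nth_default // (leq_trans sz).
rewrite rmorphD /= map_polyC /= map_polyZ /= map_polyX !hornerE.
simpc; rewrite eq_complex /= => /andP[/eqP e1 /eqP e2].
have r1 : r`_1 = 0.
  by apply/eqP; move/eqP: e2; rewrite ?mulf_eq0 (negPf b0) ?orbF.
by move: e1; rewrite r1 mul0r addr0 => ->; rewrite scale0r addr0.
Qed.

(** Induction on the size: a nonconstant [A] has a complex root, which must be real. It is split
    off, and it is not a root of the quotient because [quad a 0], the square of [X - a], does not
    divide [A]. *)
Lemma split_of_quad_free {R : rcfType} (A : {poly R}) :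
  A != 0 -> (forall s t, ~~ (quad s t %| A)) ->
  exists z : seq R, [/\ size z = (size A).-1, uniq z & all (root A) z].
Proof.
have [m] := ubnP (size A); elim: m A => // m IH A szA A0 qA.
have [A1|A1] := leqP (size A) 1.
  by exists [::]; split=> //=; case: (size A) A1 => [|[]].
have /closed_rootP[[a b] rab] :
    size (map_poly (real_complex R) A) != 1%N.
  by rewrite size_map_poly neq_ltn A1 orbT.
have b0 : b = 0.
  by apply: contraNeq (qA a b) => b0; apply: quad_dvd_of_complex_root.
have ra : root A a.
  by move: rab; rewrite b0 -[(a +i* 0)%C]/(real_complex R a) fmorph_root.
have [B AB] := factor_theorem _ _ ra.
have B0 : B != 0 by apply: contraNneq A0 => B0; rewrite AB B0 mul0r.
have sAB : size A = (size B).+1.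
  by rewrite AB size_mulXsubC.
have qB s t : ~~ (quad s t %| B).
  by apply: contra (qA s t) => qB; rewrite AB dvdp_mulr.
have rB : ~~ root B a.
  apply: contra (qA a 0); rewrite -dvdp_XsubCl => dB.
  by rewrite /quad expr0n polyC0 addr0 expr2 AB dvdp_mul.
have [|z [sz uz rz]] := IH B _ B0 qB; first by rewrite -ltnS -sAB.
exists (a :: z); split=> /=.
- by rewrite sz sAB prednK // size_poly_gt0.
- rewrite uz andbT; apply: contra rB => az; exact: (allP rz).
- rewrite ra; apply/allP => x /(allP rz); rewrite AB rootM => ->//.
Qed.

(** * Roots of polynomials orthogonal to all polynomials of lower degree *)

Section orthogonality.
Context {R : rcfType} (n : nat) (L : {scalar {poly R}}).
Hypothesis L_pos : forall p : {poly R},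
  p != 0 -> (size p <= n.+1)%N -> 0 < L (p ^+ 2).

(** The bound [n.+2] on the size is what makes the cofactor [B] of the quadratic small enough for
    orthogonality, and [(X - s) B] small enough for positivity. *)
Lemma orthogonal_quad_free (A : {poly R}) (s t : R) : A != 0 ->
  (size A <= n.+2)%N ->
  (forall r : {poly R}, (size r <= n)%N -> L (A * r) = 0) ->
  ~~ (quad s t %| A).
Proof.
move=> A0 szA oA; apply/negP => /dvdpP[B AB].
have q0 : quad s t != 0 by rewrite -size_poly_gt0 size_quad.
have B0 : B != 0 by apply: contraNneq A0 => B0; rewrite AB B0 mul0r.
have szB : (size B <= n)%N.
  by move: szA; rewrite AB size_mul // size_quad addn3.
have XB0 : ('X - s%:P) * B != 0 by rewrite mulf_neq0 ?polyXsubC_eq0.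
have := oA B szB.
have -> : A * B = (('X - s%:P) * B) ^+ 2 + t ^+ 2 *: B ^+ 2.
  by rewrite AB /quad -mul_polyC; ring.
rewrite linearD linearZ /= => /eqP; apply/negP; rewrite gt_eqF //.
apply: ltr_wpDr; first by rewrite mulr_ge0 ?sqr_ge0 // ltW // L_pos // ltnW.
by rewrite L_pos // mulrC size_mulXsubC.
Qed.

Lemma orthogonal_no_common_root (A B : {poly R}) (x : R) :
  A \is monic -> B \is monic -> size A = n.+1 -> size B = n.+2 ->
  (forall r : {poly R}, (size r <= n)%N -> L (A * r) = 0) ->
  (forall r : {poly R}, (size r <= n)%N -> L (B * r) = 0) ->
  root A x -> ~~ root B x.
Proof.
move=> mA mB szA szB oA oB /factor_theorem[C AC]; apply/negP.
move=> /factor_theorem[D BD].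
have C0 : C != 0.
  apply: contraTneq mA => C0.
  by rewrite AC C0 mul0r monicE lead_coef0 eq_sym oner_eq0.
have mD : D \is monic by move: mB; rewrite BD monicMr ?monicXsubC.
have szC : size C = n by apply: succn_inj; rewrite -szA AC size_mulXsubC.
have szD : size D = n.+1.
  by apply: succn_inj; rewrite -szB BD size_mulXsubC ?monic_neq0.
have szDA := leq_size_monicB mD mA szD szA.
have : L (A * D) = 0.
  (* Both products equal [A B / (X - x)]. *)
  have <- : L (B * C) = L (A * D) by congr (L _); rewrite AC BD; ring.
  by rewrite oB // szC.
rewrite -[D](subrK A) mulrDr linearD /= oA // add0r -expr2.
by apply/eqP; rewrite gt_eqF // L_pos ?monic_neq0 ?szA.
Qed.
End orthogonality.

(** * Limits of matrices and differentiation of a bilinear form in an inverse *)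

Lemma cvg_mxP {T : topologicalType} {U : Type} (F : set_system U)
    {FF : Filter F} m n (f : U -> 'M[T]_(m, n)) (A : 'M[T]_(m, n)) :
  f x @[x --> F] --> A <-> forall i j, f x i j @[x --> F] --> A i j.
Proof.
split=> [fA i j P AP|fA P [Q AQ QP]].
  apply: (fA [set B | P (B i j)]).
  (* This family constrains the entry [(i, j)] only; at other indices the implication is vacuous. *)
  exists (fun i' j' => [set t | (i', j') = (i, j) -> P t]).
    move=> i' j'; have [[-> ->]|ne] := eqVneq (i', j') (i, j).
      by apply: filterS AP => t Pt _.
    by apply: filterS filterT => t _ /= e; rewrite e eqxx in ne.
  by move=> B BP; apply: BP.
apply: filterS (_ : F [set x | forall i j, Q i j (f x i j)]).
  by move=> x; apply: QP.
apply: filter_forall => i; apply: filter_forall => j; exact: fA.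
Qed.

Section matrix_limits.
Context {R : numFieldType} {U : Type} (F : set_system U) {FF : Filter F}.

Lemma cvg_mulmx m n p (f : U -> 'M[R]_(m, n)) (g : U -> 'M[R]_(n, p))
    (A : 'M[R]_(m, n)) (B : 'M[R]_(n, p)) :
  f x @[x --> F] --> A -> g x @[x --> F] --> B ->
  f x *m g x @[x --> F] --> A *m B.
Proof.
move=> /cvg_mxP fA /cvg_mxP gB; apply/cvg_mxP => i j; rewrite mxE.
under eq_fun do rewrite mxE.
by apply: cvg_big => [|k _]; [exact: add_continuous|apply: cvgM].
Qed.

Lemma cvg_det n (f : U -> 'M[R]_n) (A : 'M[R]_n) :
  f x @[x --> F] --> A -> \det (f x) @[x --> F] --> \det A.
Proof.
move=> /cvg_mxP fA; apply: cvg_big => [|s _]; first exact: add_continuous.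
by apply: cvgM; [exact: cvg_cst|apply: cvg_big => // ; exact: mul_continuous].
Qed.

(** By Cramer's formula the inverse is the adjugate over the determinant, and cofactors are
    themselves determinants. The formula describes [invmx (f x)] only where [f x] is invertible,
    which holds eventually because the limit of the determinants is nonzero. *)
Lemma cvg_invmx n (f : U -> 'M[R]_n) (A : 'M[R]_n) : A \in unitmx ->
  f x @[x --> F] --> A -> invmx (f x) @[x --> F] --> invmx A.
Proof.
move=> uA fA; have dA := cvg_det fA; have /cvg_mxP fAij := fA.
have d0 : \det A != 0 by rewrite -unitfE -unitmxE.
have -> : invmx A = (\det A)^-1 *: \adj A by rewrite /invmx uA.
have : (\det (f x))^-1 *: \adj (f x) @[x --> F] --> (\det A)^-1 *: \adj A.
  apply/cvg_mxP => i j; under eq_fun do rewrite 2!mxE.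
  have -> : ((\det A)^-1 *: \adj A) i j = (\det A)^-1 * cofactor A j i.
    by rewrite !mxE.
  rewrite /cofactor; apply: cvgM; first exact: cvgV.
  apply: cvgM; first exact: cvg_cst.
  apply: (cvg_det (f := fun x => row' j (col' i (f x)))).
  apply/cvg_mxP => k l; under eq_fun do rewrite 2!mxE.
  have -> : row' j (col' i A) k l = A (lift j k) (lift i l) by rewrite !mxE.
  exact: fAij.
apply: cvg_trans; apply: near_eq_cvg; near=> x.
rewrite /invmx unitmxE unitfE ifT //.
near: x; exact: (cvgr_neq0 _ dA).
Unshelve. all: by end_near. Qed.

End matrix_limits.

(** This is the product rule, with [- G^-1 dG G^-1] as derivative of the inverse. It suffices that
    the data be affine along the line through [u] in direction [v]. *)
Lemma is_derive_bilinear_invmx (R : numFieldType) (V : normedModType R)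
    (n : nat) (a b : V -> 'cV[R]_n) (G : V -> 'M[R]_n) (u v : V) (da db : 'cV[R]_n)
    (dG : 'M[R]_n) :
  (forall h, a (h *: v + u) = a u + h *: da) ->
  (forall h, b (h *: v + u) = b u + h *: db) ->
  (forall h, G (h *: v + u) = G u + h *: dG) ->
  G u \in unitmx ->
  is_derive u v (fun w => ((b w)^T *m invmx (G w) *m a w) 0 0)
   ((db^T *m (invmx (G u) *m a u)) 0 0
    - (((b u)^T *m invmx (G u)) *m dG *m (invmx (G u) *m a u)) 0 0
    + ((b u)^T *m invmx (G u) *m da) 0 0).
Proof.
move=> aE bE GE uG.
set W := (X in is_derive _ _ _ X).
set C := (fun w => _).
have affine m p (A B : 'M[R]_(m, p)) : (A + h *: B) @[h --> 0^'] --> A.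
  apply/cvg_mxP => i j; under eq_fun do rewrite !mxE.
  suff : (A i j + h * B i j) @[h --> 0^'] --> A i j + 0 * B i j.
    by rewrite mul0r addr0.
  apply: cvgD; first exact: cvg_cst.
  by apply: cvgM; [exact: nbhs_dnbhs|exact: cvg_cst].
have Gcvg := affine _ _ (G u) dG.
suff cvgW : (fun h => h^-1 *: ((C \o shift u) (h *: v) - C u)) @ 0^' --> W.
  split; [by apply/cvg_ex; exists W|exact: cvg_lim].
pose g (h : R) := invmx (G u + h *: dG).
(* For small nonzero [h] this expression is the difference quotient itself. *)
have : (db^T *m (g h *m (a u + h *: da))) 0 0
    - (((b u)^T *m invmx (G u)) *m dG *m (g h *m (a u + h *: da))) 0 0
    + ((b u)^T *m invmx (G u) *m da) 0 0 @[h --> 0^'] --> W.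
  have c : g h *m (a u + h *: da) @[h --> 0^'] --> invmx (G u) *m a u.
    by apply: cvg_mulmx (affine _ _ _ _); apply: (cvg_invmx uG Gcvg).
  apply: cvgD; last exact: cvg_cst.
  have cM (B : 'M[R]_(1, n)) :
      (B *m (g h *m (a u + h *: da))) 0 0 @[h --> 0^'] -->
      (B *m (invmx (G u) *m a u)) 0 0.
    suff /cvg_mxP : B *m (g h *m (a u + h *: da)) @[h --> 0^'] -->
      B *m (invmx (G u) *m a u) by exact.
    by apply: cvg_mulmx c; exact: cvg_cst.
  exact: cvgB.
apply: cvg_trans; apply: near_eq_cvg; near=> h.
have h0 : h != 0 by near: h; exact: nbhs_dnbhs_neq.
have uh : G u + h *: dG \in unitmx.
  rewrite unitmxE unitfE; near: h; apply: (cvgr_neq0 _ (cvg_det Gcvg)).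
  by rewrite -unitfE -unitmxE.
(* Resolvent identity: it reduces the difference quotient to the continuity of
   [g], without differentiating the inverse. *)
have gE : g h = invmx (G u) - h *: (invmx (G u) *m dG *m g h).
  apply/eqP; rewrite eq_sym subr_eq; apply/eqP.
  rewrite -[LHS](mulmxK uh) -/(g h) mulmxDr mulVmx // mulmxDl mul1mx.
  by rewrite -scalemxAr -scalemxAl.
set ah := a u + h *: da; set x := g h *m ah.
have xE : x = invmx (G u) *m ah - h *: (invmx (G u) *m dG *m x).
  by rewrite {1}/x gE mulmxBl -scalemxAl /x !mulmxA.
rewrite /C /= aE bE GE -/(g h) -/ah.
have -> : (b u + h *: db)^T *m g h *m ah = (b u)^T *m invmx (G u) *m a u
   + h *: (db^T *m x - (b u)^T *m invmx (G u) *m dG *m x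
           + (b u)^T *m invmx (G u) *m da).
  have -> : (b u + h *: db)^T = (b u)^T + h *: db^T.
    by apply/matrixP => i j; rewrite !mxE.
  rewrite -mulmxA -/x; move: x xE => x xE.
  rewrite mulmxDl -scalemxAl {1}xE mulmxBr -scalemxAr.
  rewrite {1}/ah !mulmxDr -!scalemxAr !scalerDr scalerN !mulmxA -!addrA.
  by congr (_ + _); rewrite addrC [X in X + _]addrC -addrA.
move: (db^T *m x) ((b u)^T *m invmx (G u) *m dG *m x)
  ((b u)^T *m invmx (G u) *m da) ((b u)^T *m invmx (G u) *m a u) => A1 A2 A3 A4.
by rewrite !mxE [in RHS]addrC addrK; apply/esym/mulKf.
Unshelve. all: by end_near. Qed.

(** * The moment functional and its positivity on squares *)

Definition moment_functional (R : comNzRingType) (M : nat) (u : 'cV[R]_M.+1)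
  (p : {poly R}) : R := \sum_(k < M.+1) p`_k * u k 0.

Fact moment_functional_is_linear (R : comNzRingType) (M : nat)
    (u : 'cV[R]_M.+1) :
  scalar (moment_functional u).
Proof.
move=> a p q; rewrite /moment_functional mulr_sumr -big_split /=.
by apply: eq_bigr => k _; rewrite !coefE mulrDl mulrA.
Qed.

HB.instance Definition _ (R : comNzRingType) (M : nat) (u : 'cV[R]_M.+1) :=
  GRing.isLinear.Build R {poly R} R *%R (moment_functional u)
    (moment_functional_is_linear u).

Lemma moment_functionalXn (R : realType) (M k : nat) (u : 'cV[R]_M.+1) :
  (k <= M)%N -> moment_functional u 'X^k = moment u k.
Proof.
move=> kM; rewrite /moment_functional /moment (bigD1 (inord k)) //=.
rewrite coefXn inordK // eqxx mul1r big1 ?addr0 // => i ik.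
rewrite coefXn (_ : (_ == _) = false) ?mul0r //.
by apply: contraNF ik => /eqP <-; rewrite inord_val.
Qed.

Lemma negligible_root (R : realType) (p : {poly R}) : p != 0 ->
  (@lebesgue_measure R).-negligible [set c | p.[c] = 0].
Proof.
have [m] := ubnP (size p); elim: m p => // m IH p szp p0.
have [[a ra]|nr] := pselect (exists a, root p a); last first.
  apply: negligibleS (negligible_set0 _) => c /= pc.
  by apply: nr; exists c; apply/rootP.
have [q pq] := factor_theorem _ _ ra.
have q0 : q != 0 by apply: contraNneq p0 => q0; rewrite pq q0 mul0r.
have nq : (@lebesgue_measure R).-negligible [set c | q.[c] = 0].
  by apply: IH => //; rewrite -ltnS -(size_mulXsubC a q0) -pq.
have na : (@lebesgue_measure R).-negligible [set a].
  by apply/negligibleP; [|exact: lebesgue_measure_set1].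
apply: negligibleS (negligibleU nq na) => c /= /eqP.
rewrite pq hornerM hornerXsubC mulf_eq0 subr_eq0.
by case/orP => /eqP; [left|right].
Qed.

(** The value is the integral of [p^2 f]. If it were zero, [p^2 f] would vanish almost everywhere,
    hence so would [f], the zeros of [p] being negligible. The size bound matters because
    [moment_functional] drops all coefficients beyond degree [M]. *)
Lemma moment_functional_sqr_gt0 (R : realType) (M : nat) (u : 'cV[R]_M.+1)
    (p : {poly R}) :
  realizable u -> p != 0 -> (size (p ^+ 2) <= M.+1)%N ->
  0 < moment_functional u (p ^+ 2).
Proof.
move=> [f [mf f0 fn0 fint uE]] p0 sp; set q := p ^+ 2 in sp *.
pose mu := @lebesgue_measure R.
have mom k : (u k 0)%:E = (\int[mu]_c (c ^+ k * f c)%:E)%E.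
  by rewrite uE /Rintegral fineK // integrable_fin_num.
have Lq : (moment_functional u q)%:E = (\int[mu]_c (q.[c] * f c)%:E)%E.
  rewrite /moment_functional -sumEFin.
  under eq_integral => c _.
    rewrite (horner_coef_wide _ sp) mulr_suml -sumEFin.
    under eq_bigr do rewrite -mulrA EFinM.
    over.
  rewrite integral_sum //=; last by move=> k; apply: integrableZl.
  by apply: eq_bigr => k _; rewrite integralZl // -mom EFinM.
have q0 c : 0 <= q.[c] * f c by rewrite /q hornerE mulr_ge0 ?sqr_ge0.
rewrite lt_neqAle -lee_fin Lq integral_ge0 ?andbT; last first.
  by move=> c _; rewrite lee_fin.
apply/negP => /eqP L0; apply: fn0.
have : ae_eq mu setT (fun c => (q.[c] * f c)%:E) (cst 0%E).
  apply/(ae_eq_integral_abs mu measurableT).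
    apply/measurable_EFinP; apply: measurable_funM => //.
    by apply: continuous_measurable_fun; apply: continuous_horner.
  by under eq_integral do rewrite gee0_abs ?lee_fin //; rewrite -Lq -L0.
rewrite /ae_eq /almost_everywhere => h1.
apply: negligibleS (negligibleU h1 (negligible_root p0)) => c /= fc.
have [pc|pc] := eqVneq p.[c] 0; first by right.
left => /(_ I) /= [] /eqP.
rewrite mulf_eq0 /q hornerE expf_eq0 (negPf pc) /= => /eqP.
exact: fc.
Qed.


(** * Gramian matrices, their orthogonal polynomials and the closure *)

Lemma rVpolyE (R : nzRingType) (n : nat) (v : 'rV[R]_n) :
  rVpoly v = \sum_(i < n) v 0 i *: 'X^i.
Proof.
rewrite /rVpoly poly_def; apply: eq_bigr => i _; congr (_ *: _).
by rewrite insubT // => lt_in; congr (v 0 _); apply: val_inj.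
Qed.

Lemma leq_size_sqr (R : idomainType) (n m : nat) (p : {poly R}) :
  (size p <= n)%N -> (n + n <= m.+1)%N -> (size (p ^+ 2) <= m)%N.
Proof.
move=> pn nm; rewrite expr2 (leq_trans (size_polyMleq _ _)) //.
by rewrite -subn1 leq_subLR add1n (leq_trans _ nm) // leq_add.
Qed.

Section gramian.
Context {R : realType} {M : nat}.
Implicit Types u v : 'cV[R]_M.+1.

Lemma moment_functional_pos_def u n : realizable u -> (n + n <= M)%N ->
  forall p : {poly R}, p != 0 -> (size p <= n.+1)%N ->
  0 < moment_functional u (p ^+ 2).
Proof.
move=> ru nM p p0 sp; rewrite moment_functional_sqr_gt0 // (leq_size_sqr sp) //.
by rewrite addSn addnS.
Qed.

Lemma moment_linear (h : R) u v k :
  moment (h *: v + u) k = moment u k + h * moment v k.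
Proof. by rewrite /moment !mxE addrC. Qed.

Lemma moments_from_linear (h : R) u v k m :
  moments_from (h *: v + u) k m = moments_from u k m + h *: moments_from v k m.
Proof. by apply/matrixP => i j; rewrite !mxE moment_linear. Qed.

Lemma gramian_linear (h : R) u v m :
  gramian (h *: v + u) m = gramian u m + h *: gramian v m.
Proof. by apply/matrixP => i j; rewrite !mxE moment_linear. Qed.

Lemma tr_gramian u m : (gramian u m)^T = gramian u m.
Proof. by apply/matrixP => i j; rewrite !mxE addnC. Qed.

(** Together with [moment_functional_rVpolyM], this translates the matrix products in the closure
    and in its derivative into values of the functional on products of polynomials. *)
Lemma moment_functional_Xn_rVpoly u k n (w : 'cV[R]_n) : (k + n <= M.+1)%N ->
  moment_functional u ('X^k * rVpoly w^T) = ((moments_from u k n)^T *m w) 0 0.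
Proof.
move=> kM; rewrite rVpolyE mulr_sumr linear_sum mxE; apply: eq_bigr => i _ /=.
rewrite -scalerAr linearZ /= -exprD moment_functionalXn ?mxE 1?mulrC //.
by rewrite -ltnS (leq_trans _ kM) // -addnS leq_add2l.
Qed.

Lemma moment_functional_rVpolyM u n (w x : 'cV[R]_n) : (n + n <= M.+2)%N ->
  moment_functional u (rVpoly w^T * rVpoly x^T) = (w^T *m gramian u n *m x) 0 0.
Proof.
move=> nM; rewrite -mulmxA (rVpolyE w^T) mulr_suml linear_sum mxE.
apply: eq_bigr => i _ /=; rewrite -scalerAl linearZ /=; congr (_ * _).
rewrite moment_functional_Xn_rVpoly.
  by rewrite !mxE; apply: eq_bigr => j _; rewrite !mxE.
by rewrite -ltnS (leq_trans _ nM) // -addSn leq_add2r.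
Qed.

(** Once the derivative in direction [v] is [moment_functional v] of a fixed polynomial, this reads
    off the partial derivatives as its coefficients. *)
Lemma moment_functional_delta (j : 'I_M.+1) (p : {poly R}) :
  moment_functional (delta_mx j 0) p = p`_j.
Proof.
rewrite /moment_functional (bigD1 j) //= big1 => [|k kj].
  by rewrite mxE !eqxx mulr1 addr0.
by rewrite mxE (negPf kj) mulr0.
Qed.

(** A kernel vector, read as a polynomial [p] of degree less than [n], would give [L(p^2) = 0]. *)
Lemma gramian_unit u n : realizable u -> (n + n <= M.+2)%N ->
  gramian u n \in unitmx.
Proof.
move=> ru nM; rewrite unitmxE unitfE; apply/negP => /det0P[v v0 vG].
have p0 : rVpoly v != 0.
  by apply: contraNneq v0 => p0; rewrite -(rVpolyK v) p0 linear0.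
have sp : (size (rVpoly v ^+ 2) <= M.+1)%N.
  by apply: (leq_size_sqr (n := n)); rewrite ?size_poly.
have := moment_functional_sqr_gt0 ru p0 sp.
have := moment_functional_rVpolyM u v^T v^T nM.
by rewrite trmxK -expr2 vG mul0mx mxE => ->; rewrite ltxx.
Qed.

(** For realizable moments and [m] equal to [n] or [n.+1], this is [X^m] minus its [L]-orthogonal
    projection onto the polynomials of degree less than [n]; these two values of [m] give the two
    factors of the characteristic polynomial. *)
Definition gram_poly u n m : {poly R} :=
  'X^m - rVpoly (invmx (gramian u n) *m moments_from u m n)^T.

(** These are the normal equations: with [c] the moment vector paired with [X^m] and [w] the
    coefficients of [r], symmetry of [G] gives [(G^-1 c)^T G w = c^T w]. *)
Lemma gram_poly_orthogonal u n m : gramian u n \in unitmx ->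
  (m + n <= M.+1)%N -> (n + n <= M.+2)%N ->
  forall r : {poly R}, (size r <= n)%N ->
  moment_functional u (gram_poly u n m * r) = 0.
Proof.
move=> uG mM nM r sr.
have rE : r = rVpoly ((poly_rV r : 'rV_n)^T)^T by rewrite trmxK poly_rV_K.
rewrite rE mulrBl linearB /= moment_functional_Xn_rVpoly //.
rewrite moment_functional_rVpolyM // trmx_mul trmx_inv tr_gramian mulmxKV //.
by rewrite subrr.
Qed.

Lemma size_gram_poly u n m : (n <= m)%N -> size (gram_poly u n m) = m.+1.
Proof.
move=> nm; rewrite size_polyDl size_polyXn // size_polyN ltnS.
by rewrite (leq_trans _ nm) // size_poly.
Qed.

Lemma monic_gram_poly u n m : (n <= m)%N -> gram_poly u n m \is monic.
Proof.
move=> nm; rewrite monicE lead_coefDl ?lead_coefXn // size_polyXn size_polyN.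
by rewrite ltnS (leq_trans _ nm) // size_poly.
Qed.

(** With [p] and [q] also denoting the polynomials they encode, the product rule yields the
    functional of [v] at [X^(n+1) p - q p + X^n q], which is [X^(2n+1)] minus
    [(X^n - p) (X^(n+1) - q)]. *)
Lemma is_derive_gramian_closure u v n : gramian u n \in unitmx ->
  (n.+1 + n <= M.+1)%N ->
  is_derive u v (@gramian_closure R M n)
    (moment_functional v
       ('X^(n.+1 + n) - gram_poly u n n * gram_poly u n n.+1)).
Proof.
move=> uG nM.
pose p := invmx (gramian u n) *m moments_from u n n.
pose q := invmx (gramian u n) *m moments_from u n.+1 n.
have -> : 'X^(n.+1 + n) - gram_poly u n n * gram_poly u n n.+1 =
    'X^(n.+1) * rVpoly p^T - rVpoly q^T * rVpoly p^T + 'X^n * rVpoly q^T.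
  by rewrite /gram_poly -/p -/q exprD; ring.
have qE : (moments_from u n.+1 n)^T *m invmx (gramian u n) = q^T.
  by rewrite /q trmx_mul trmx_inv tr_gramian.
rewrite linearD linearB /= !moment_functional_Xn_rVpoly //; last first.
  by rewrite (leq_trans _ nM) // leq_add2r.
rewrite moment_functional_rVpolyM; last first.
  by rewrite (leq_trans _ (leqW nM)) // leq_add2r.
have -> : ((moments_from v n n)^T *m q) 0 0 = (q^T *m moments_from v n n) 0 0.
  by rewrite -[in RHS](trmxK (moments_from v n n)) -trmx_mul [in RHS]mxE.
rewrite -qE /p; apply: is_derive_bilinear_invmx => // h.
- exact: moments_from_linear.
- exact: moments_from_linear.
- exact: gramian_linear.
Qed.

Lemma char_poly_gramian_closure u n : gramian u n \in unitmx ->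
  M = (n + n)%N ->
  char_poly_closure (@gramian_closure R M n) u =
  gram_poly u n n * gram_poly u n n.+1.
Proof.
move=> uG ME; rewrite /char_poly_closure.
have nM : (n.+1 + n <= M.+1)%N by rewrite ME.
have dE v := @derive_val _ _ _ _ _ _ _ (is_derive_gramian_closure v uG nM).
under eq_bigr do rewrite dE moment_functional_delta.
rewrite -(poly_def M.+1 (fun j => _`_j)).
set S := 'X^(n.+1 + n) - _.
(* The leading terms of two monic polynomials cancel, so the coefficients of [S] up to degree [M]
   determine it. *)
have sS : (size S <= M.+1)%N.
  apply: leq_size_monicB; first exact: monicXn.
  - by rewrite monicMl monic_gram_poly.
  - by rewrite size_polyXn ME.
  rewrite size_Mmonic ?monic_neq0 ?monic_gram_poly // !size_gram_poly //.
  by rewrite ME !addnS !addSn.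
rewrite (_ : \poly_(_ < _) _ = S).
  by rewrite /S opprB ME -addSn addrC subrK.
apply/polyP => i; rewrite coef_poly; case: ltnP => // iM.
by rewrite nth_default // (leq_trans sS).
Qed.

(** The bound [m <= n.+1] serves twice: it keeps the degree within reach of [orthogonal_quad_free],
    and it keeps the moments involved within order [M]. *)
Lemma gram_poly_roots u n m : realizable u ->
  (n + n <= M)%N -> (n <= m <= n.+1)%N ->
  exists z : seq R, [/\ size z = m, uniq z & all (root (gram_poly u n m)) z].
Proof.
move=> ru nM /andP[nm mn].
have uG : gramian u n \in unitmx by rewrite gramian_unit // !leqW.

have g0 : gram_poly u n m != 0 by rewrite monic_neq0 ?monic_gram_poly.
have qf s t : ~~ (quad s t %| gram_poly u n m).
  apply: (orthogonal_quad_free (n := n) (L := moment_functional u)) => //.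
  - exact: moment_functional_pos_def.
  - by rewrite size_gram_poly.
  - apply: gram_poly_orthogonal => //; last by rewrite !leqW.
    by rewrite (leq_trans (leq_add mn (leqnn n))).
have [z [sz uz rz]] := split_of_quad_free g0 qf.
by exists z; split=> //; rewrite sz size_gram_poly.
Qed.
End gramian.

Theorem corollary5p1 (R : realType) (M n : nat)
  (M_even : ~~ odd M) (M_ge2 : (2 <= M)%N) (def_n : n = M./2) :
  strictly_hyperbolic (fun u : 'cV[R]_M.+1 => gramian_closure n u).
Proof.
have ME : M = (n + n)%N by rewrite def_n addnn even_halfK.
have nM : (n + n <= M)%N by rewrite ME.
move=> u ru; have uG : gramian u n \in unitmx by rewrite gramian_unit // !leqW.
split=> [j|].
  have /(is_derive_gramian_closure (delta_mx j 0)) d := uG.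
  by apply: ex_derive; apply: d; rewrite ME.
have [|z1 [sz1 uz1 rz1]] := gram_poly_roots (m := n) ru nM.
  by rewrite leqnn leqnSn.
have [|z2 [sz2 uz2 rz2]] := gram_poly_roots (m := n.+1) ru nM.
  by rewrite leqnn leqnSn.
(* The factors contribute [n] and [n.+1] roots, in total [M.+1]; the two lists are disjoint because
   the factors share no root. *)
exists (z1 ++ z2); split.
- by rewrite size_cat sz1 sz2 addnS ME.
- rewrite cat_uniq uz1 uz2 andbT /=; apply/hasPn => x /(allP rz2) r2.
  apply/negP => /(allP rz1) r1; move: r2; apply/negP.
  apply: (orthogonal_no_common_root (n := n) (L := moment_functional u)) r1.
  + exact: moment_functional_pos_def.
  + exact: monic_gram_poly.
  + exact: monic_gram_poly.
  + exact: size_gram_poly.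
  + exact: size_gram_poly.
  + by apply: gram_poly_orthogonal; rewrite // ?leqW.
  + by apply: gram_poly_orthogonal; rewrite // ?leqW.
rewrite (char_poly_gramian_closure uG ME) all_cat.
apply/andP; split; apply/allP => x.
  by move/(allP rz1); rewrite rootM => ->.
by move/(allP rz2); rewrite rootM orbC => ->.
Qed.
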